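(* For every continuous function $\varphi:\mathbb{C}\to\mathbb{C}$ such that $\psi(t):=|\varphi(e^{it})|^2$ belongs to $\Psi$, every $x\in H$ and every $\sigma>0$, $$E_\sigma(x)\le\left(\frac43\right)^{1/2}\frac{1}{\sqrt{\mathcal{I}(\psi)}}\;\omega_\varphi\!\left(x;L_{p,\widehat V}\!\left(\left[0,\tfrac{\pi}{\sigma}\right]\right)\right),\qquad 2\le p\le\infty.$$
   Context: $H$ is a complex Hilbert space with norm $\|\cdot\|$. $E$ is a resolution of the identity on the Borel $\sigma$-algebra of $\mathbb{R}$ in $H$: to each Borel set $\beta$ is assigned an orthogonal projection $E(\beta)$ in $H$, with $E(\emptyset)=0$, $E(\mathbb{R})=I$, and $E(\bigcup_j\beta_j)=\sum_jE(\beta_j)$ (strongly) for pairwise disjoint sequences of Borel sets. $dE(t)$ denotes integration with respect to this projection-valued measure. For $\sigma>0$ put $W_\sigma=\{\int_{|t|<\sigma}dE(t)g: g\in H\}$ and $E_\sigma(x)=\inf_{h\in W_\sigma}\|x-h\|$. $\Phi$ is the set of continuous nonnegative $2\pi$-periodic functions $\psi:\mathbb{R}\to\mathbb{R}$ with nowhere dense zero set and $\psi(0)=0$. $\Psi$ is the set of $\psi\in\Phi$ such that (1) $\psi(-t)=\psi(t)$ and $\psi(\pi-t)=\psi(\pi+t)$ for $t\in\mathbb{R}$; (2) $\frac1t\int_0^t\psi(s)\,ds\le\frac1\pi\int_0^\pi\psi(s)\,ds$ for every $t\in(0,\pi)$. $\mathcal{I}(\psi)=\frac1{2\pi}\int_0^{2\pi}\psi(t)\,dt$.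 For $x\in H$, $t\in\mathbb{R}$ put $\Delta_t^\varphi x=\int_{-\infty}^{\infty}\varphi(e^{its})\,dE(s)x$. The weight $\widehat V$ on $[0,1]$ is $\widehat V(t)=5/4$ for $t\in[0,1/2]$ and $\widehat V(t)=3/4$ for $t\in(1/2,1]$. For a weight $V$ on $[0,1]$ (nonnegative, integrable, nonzero a.e., $\int_0^1V=1$), $\delta>0$ and $1\le p<\infty$, $$\omega_\varphi(x;L_{p,V}([0,\delta]))=\left(\frac1\delta\int_0^\delta\|\Delta_t^\varphi x\|^p\,V\!\left(\frac t\delta\right)dt\right)^{1/p},$$ and for $p=\infty$ this quantity is understood as $\omega_\varphi(x;C([0,\delta]))=\max_{0\le t\le\delta}\|\Delta_t^\varphi x\|$. *)

(* Defs.v *)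
From HB Require Import structures.
From mathcomp Require Import all_boot all_order all_algebra.
From mathcomp Require Import all_classical all_reals all_analysis.
From mathcomp Require Export complex.

Set Implicit Arguments.
Unset Strict Implicit.
Unset Printing Implicit Defensive.

Import Order.TTheory GRing.Theory Num.Theory.
Import numFieldNormedType.Exports.

Local Open Scope classical_set_scope.
Local Open Scope ring_scope.

(* The library's norm on a normed module over R[i] takes its values in R[i]. *)
Definition rnorm (R : realType) (V : normedZmodType R[i]) (x : V) : R :=
  complex.Re `|x|.

Definition orth_projection (R : realType) (H : lmodType R[i])
    (dot : H -> H -> R[i]) (P : H -> H) : Prop :=
  [/\ linear P, (forall x, P (P x) = P x) &
      (forall x y, dot (P x) y = dot x (P y))].

(* Only the values of E on Borel sets are constrained. *)
Record resolution_of_identity (R : realType) (H : completeNormedModType R[i])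
    (dot : H -> H -> R[i]) (E : set R -> H -> H) : Prop := ResolutionOfIdentity {
  roi_proj : forall B, measurable B -> orth_projection dot (E B) ;
  roi_set0 : forall x, E set0 x = 0 ;
  roi_setT : forall x, E setT x = x ;
  roi_sigma_additive : forall (B : nat -> set R) (x : H),
    (forall j, measurable (B j)) -> trivIset setT B ->
    series (fun j => E (B j) x) @ \oo --> E (\bigcup_j B j) x }.

Definition simple_spectral_integral (R : realType)
    (H : completeNormedModType R[i]) (E : set R -> H -> H)
    (s : {fimfun R >-> R[i]}) (x : H) : H :=
  \sum_(c \in range s) c *: E (s @^-1` [set c]) x.

(* v is the integral of f dE x over D when v is the limit of the integrals of
   some Borel simple functions converging uniformly to f * 1_D. When E is a
   resolution of the identity such a v is unique, because simple functions
   satisfy |simple_spectral_integral E s x| <= sup |s| * |x|, and it exists as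
   soon as f * 1_D is Borel and bounded. *)
Definition is_spectral_integral (R : realType) (H : completeNormedModType R[i])
    (E : set R -> H -> H) (D : set R) (f : R -> R[i]) (x v : H) : Prop :=
  exists s : nat -> {fimfun R >-> R[i]},
    [/\ forall n c, measurable (s n @^-1` [set c]),
        {uniform, (fun n => (s n : R -> R[i]^o)) @ \oo -->
           ((fun t => \1_D t * f t) : R -> R[i]^o)} &
        (fun n => simple_spectral_integral E (s n) x) @ \oo --> v].

Definition spectral_integral (R : realType) (H : completeNormedModType R[i])
    (E : set R -> H -> H) (D : set R) (f : R -> R[i]) (x : H) : H :=
  xget 0 [set v | is_spectral_integral E D f x v].

Definition W (R : realType) (H : completeNormedModType R[i])
    (E : set R -> H -> H) (sigma : R) : set H :=
  [set spectral_integral E [set t | `|t| < sigma] (cst 1) g | g in [set: H]].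

Definition best_approx (R : realType) (H : completeNormedModType R[i])
    (E : set R -> H -> H) (sigma : R) (x : H) : R :=
  inf [set rnorm (x - h) | h in W E sigma].

Definition expi (R : realType) (t : R) : R[i] := Complex (cos t) (sin t).

Definition symbol (R : realType) (phi : R[i] -> R[i]) (t : R) : R :=
  rnorm (phi (expi t)) ^+ 2.

Definition Delta (R : realType) (H : completeNormedModType R[i])
    (E : set R -> H -> H) (phi : R[i] -> R[i]) (t : R) (x : H) : H :=
  spectral_integral E setT (fun s => phi (expi (t * s))) x.

Definition Phi (R : realType) (psi : R -> R) : Prop :=
  [/\ continuous psi, forall t, 0 <= psi t, periodic psi (pi *+ 2),
      (closure [set t | psi t = 0])° = set0 & psi 0 = 0].

Definition mean_value (R : realType) (psi : R -> R) : R :=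
  (2 * pi)^-1 * \int[lebesgue_measure]_(t in `[0, 2 * pi]) psi t.

Definition Psi (R : realType) (psi : R -> R) : Prop :=
  [/\ Phi psi,
      forall t, psi (- t) = psi t,
      forall t, psi (pi - t) = psi (pi + t) &
      forall t, 0 < t < pi ->
        t^-1 * \int[lebesgue_measure]_(s in `[0, t]) psi s <=
        pi^-1 * \int[lebesgue_measure]_(s in `[0, pi]) psi s].

Definition Vhat (R : realType) (t : R) : R := if t <= 1 / 2 then 5 / 4 else 3 / 4.

(* V is a weight on [0, 1]. For p = +oo the maximum over [0, delta] is written
   as a sup: t |-> Delta E phi t x is continuous when phi is, so it is attained.
   The value at p = -oo is junk. *)
Definition modulus (R : realType) (H : completeNormedModType R[i])
    (E : set R -> H -> H) (phi : R[i] -> R[i]) (p : \bar R) (V : R -> R)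
    (delta : R) (x : H) : R :=
  match p with
  | q%:E => (delta^-1 * \int[lebesgue_measure]_(t in `[0, delta])
               (rnorm (Delta E phi t x) `^ q * V (t / delta))) `^ q^-1
  | +oo%E => sup [set rnorm (Delta E phi t x) | t in `[0, delta]]
  | -oo%E => 0
  end.

(* Main.v *)
Require Import Defs.
From HB Require Import structures.
From mathcomp Require Import all_boot all_order all_algebra.
From mathcomp Require Import all_classical all_reals all_analysis.
From mathcomp Require Import complex measurable_realfun ring lra.

(** Let [mu B = |E(B) x|^2], a finite measure.  Then
    [|Delta_t x|^2 = \int psi(t s) dmu(s)] and [E_sigma(x)^2] is at most the
    [mu]-mass of [|s| >= sigma].  Integrating the first identity against the
    weight [Vhat(t / delta)] over [0, delta], [delta = pi / sigma], and using
    Tonelli, the case [p = 2] reduces to a scalar inequality: with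
    [F(T) = \int_0^T psi] and [M] the mean value of [psi],
    [3 F(T) + 2 F(T / 2) >= 3 M T] for every [T >= pi] (take [T = |s| delta]).
    For [p > 2] the power mean inequality applies, since the weight
    [Vhat(t / delta) / delta] has total mass one on [0, delta]. *)

Set Implicit Arguments.
Unset Strict Implicit.
Unset Printing Implicit Defensive.

Import Order.TTheory GRing.Theory Num.Theory.
Import numFieldNormedType.Exports.

Local Open Scope classical_set_scope.
Local Open Scope ring_scope.

(** The factor 4/3 is the inverse of the 3/4 in the scalar inequality, and the step weight is what
    makes 3/4 reachable. If [psi] is concentrated near pi, then [F T] stays close to [2 pi M] until
    [T] nears [3 pi], so a flat weight would give only 2/3. Moving mass to the first half adds a
    multiple of [F (T / 2)], which is large exactly where [F T] lags. At [T = pi], that is at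
    spectral points with |s| = sigma, [F (pi / 2)] may be negligible and 3/4 is all that remains.

    The analytic obstacle is that [spectral_integral] is a choice with default 0: nothing can be
    said of [Delta] or [W] before limits of simple integrals are shown to exist and to be unique.
    Both facts, as well as the formula for the norm of [Delta], come from Pythagoras: projections
    attached to disjoint sets have orthogonal ranges. That orthogonality is not part of
    [resolution_of_identity]; it is derived from additivity and idempotence.

    Symmetry and periodicity of [psi] are used through a primitive [F], where each becomes the
    vanishing of a derivative. *)

Lemma is_derive_ge0_le (R : realType) (f df : R -> R) (a b : R) : a <= b ->
  (forall x, x \in `[a, b] -> is_derive x 1 f (df x)) ->
  (forall x, 0 <= df x) -> f a <= f b.
Proof.
move=> ab Hdf df0.
have cf : {within `[a, b], continuous f}.
  by apply: derivable_within_continuous => x /Hdf [].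
have D x : x \in `]a, b[ -> is_derive x 1 f (df x).
  by move=> xab; apply: Hdf; apply: subset_itv_oo_cc.
have [c _ E] := MVT_segment ab D cf.
by rewrite -subr_ge0 E mulr_ge0// subr_ge0.
Qed.

Lemma is_derive0_eq (R : realType) (f : R -> R) (a b : R) : a <= b ->
  (forall x, x \in `[a, b] -> is_derive x 1 f 0) -> f b = f a.
Proof.
move=> ab df; apply/eqP; rewrite eq_le; apply/andP; split.
  rewrite -lerN2; apply: (@is_derive_ge0_le _ (fun x => - f x) (fun=> 0)) => //.
  move=> x /df dfx; have := is_deriveN dfx.
  by rewrite oppr0.
exact: (@is_derive_ge0_le _ f (fun=> 0)).
Qed.

Lemma is_derive_affine (R : realType) (c k x : R) :
  is_derive x 1 (fun t => c + k * t) k.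
Proof.
have := is_deriveD (is_derive_cst c x 1) (is_deriveZ k (is_derive_id x 1)).
by rewrite add0r scaler1.
Qed.

(** * The scalar inequality for a primitive of the symbol *)

Section primitive.
Context {R : realType}.
Variables (F psi : R -> R).
Hypothesis dF : forall t : R, -1 < t -> is_derive t 1 F (psi t).
Hypothesis F0 : F 0 = 0.
Hypothesis psi_ge0 : forall t, 0 <= psi t.
Hypothesis psi_periodic : forall t, psi (t + pi *+ 2) = psi t.
Hypothesis psi_refl : forall t, psi (pi - t) = psi (pi + t).
Hypothesis F_mean : forall t : R, 0 < t < pi -> t^-1 * F t <= pi^-1 * F pi.

Lemma primitive_homo (a b : R) : 0 <= a -> a <= b -> F a <= F b.
Proof.
move=> a0 ab; apply: (@is_derive_ge0_le _ F psi) => // x.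
by rewrite in_itv/= => /andP[ax _]; apply: dF; lra.
Qed.

(** The left side has derivative [psi (pi + t) - psi (pi - t) = 0], so it keeps its value at
    [t = 0]. The case [t = pi] yields [F (2 pi) = 2 F pi]. *)
Lemma primitive_refl (t : R) : 0 <= t <= pi ->
  F (pi + t) + F (pi - t) = F pi *+ 2.
Proof.
move=> /andP[t0 tpi].
have := @is_derive0_eq _ (fun t => F (pi + t) + F (pi - t)) 0 t t0.
rewrite addr0 subr0 -mulr2n; apply => x; rewrite in_itv/= => /andP[x0 xt].
have d1 : is_derive (pi + 1 * x) 1 F (psi (pi + x)).
  by rewrite mul1r; apply: dF; lra.
have d2 : is_derive (pi + -1 * x) 1 F (psi (pi - x)).
  by rewrite mulN1r; apply: dF; lra.
have g1 := @is_derive1_comp _ F (fun t => pi + 1 * t) x _ _ d1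
  (is_derive_affine pi 1 x).
have g2 := @is_derive1_comp _ F (fun t => pi + -1 * t) x _ _ d2
  (is_derive_affine pi (-1) x).
have := is_deriveD g1 g2; rewrite psi_refl mulr1 mulrN1 subrr.
by congr is_derive; apply/funext => u; rewrite !fctE /= mul1r mulN1r.
Qed.

Lemma primitive_shift (t : R) : 0 <= t -> F (t + pi *+ 2) = F t + F pi *+ 2.
Proof.
move=> t0.
have pi0 : 0 < pi :> R := pi_gt0 R.
have F2 : F (pi *+ 2) = F pi *+ 2.
  have pp : 0 <= (pi : R) <= pi by rewrite lexx (ltW pi0).
  by have := primitive_refl pp; rewrite subrr F0 addr0 => <-; rewrite -mulr2n.
have := @is_derive0_eq _ (fun t => F (t + pi *+ 2) - F t) 0 t t0.
rewrite add0r F0 subr0 F2 => H.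
suff /H <- : forall x, x \in `[0, t] ->
    is_derive x 1 (fun t => F (t + pi *+ 2) - F t) 0 by ring.
move=> x; rewrite in_itv/= => /andP[x0 xt].
have d1 : is_derive (pi *+ 2 + 1 * x) 1 F (psi (x + pi *+ 2)).
  by rewrite mul1r addrC; apply: dF; lra.
have d2 : is_derive x 1 F (psi x) by apply: dF; lra.
have g1 := @is_derive1_comp _ F (fun t => pi *+ 2 + 1 * t) x _ _ d1
  (is_derive_affine (pi *+ 2) 1 x).
have := is_deriveB g1 d2; rewrite psi_periodic mulr1 subrr.
by congr is_derive; apply/funext => u; rewrite !fctE /= mul1r (addrC u).
Qed.

(* Besides [0 <= F], the proof uses that [F t <= M t] on [0, pi] turns by
   reflection into [F t >= M t] on [pi, 2 pi], and that [F t - M t] is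
   2 pi-periodic and never below [- pi M]. *)
Lemma primitive_lower (T : R) : pi <= T ->
  3 / 4 * (pi^-1 * F pi) * T <= 3 / 4 * F T + 1 / 2 * F (T / 2).
Proof.
move=> piT; set M := pi^-1 * F pi.
have pi0 : 0 < pi :> R := pi_gt0 R.
have EM : F pi = pi * M by rewrite /M mulrA divff ?mul1r// gt_eqF.
have M0 : 0 <= M.
  by rewrite mulr_ge0 ?invr_ge0 ?(ltW pi0)// -F0 primitive_homo// ltW.
have Fge0 t : 0 <= t -> 0 <= F t by move=> t0; rewrite -F0 primitive_homo.
have Fup t : 0 <= t <= pi -> F t <= M * t.
  move=> /andP[]; rewrite le_eqVlt => /predU1P[<- _|t0].
    by rewrite F0 mulr0.
  rewrite le_eqVlt => /predU1P[->|tpi]; first by rewrite EM mulrC.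
  by rewrite mulrC -ler_pdivrMl// F_mean// t0.
have Flow t : pi <= t <= pi *+ 2 -> M * t <= F t.
  move=> /andP[t0 tpi].
  have tpi0 : 0 <= t - pi <= pi by lra.
  have := primitive_refl tpi0; rewrite EM addrCA subrr addr0.
  have : 0 <= pi - (t - pi) <= pi by lra.
  by move=> /Fup; move: (F t) (F _) => f1 f2; lra.
have Fn n (t : R) : 0 <= t -> F (t + (pi *+ 2) *+ n) = F t + M * (pi *+ 2) *+ n.
  elim: n => [|n IH] t0; first by rewrite !mulr0n !addr0.
  rewrite mulrSr addrA primitive_shift; last first.
    by apply: addr_ge0 => //; do 2 apply: mulrn_wge0; exact: ltW.
  by rewrite IH// EM [in RHS]mulrSr mulrnAr (mulrC pi) -addrA.
have Fgap (t : R) : 0 <= t -> M * (t - pi) <= F t.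
  move=> t0; have pi20 : 0 < pi *+ 2 :> R by rewrite mulrn_wgt0.
  have /truncn_itv/andP[] : 0 <= t / (pi *+ 2) by rewrite divr_ge0// ltW.
  set n := Num.truncn _; rewrite ler_pdivlMr// ltr_pdivrMr// => nt tn.
  have r0 : 0 <= t - (pi *+ 2) *+ n by rewrite subr_ge0 -mulr_natl.
  have r1 : t - (pi *+ 2) *+ n < pi *+ 2.
    by move: tn; rewrite -natr1 -mulr_natl; lra.
  rewrite -[t in F t](subrK ((pi *+ 2) *+ n) t) Fn// -mulrnAr.
  rewrite -lerBlDr -mulrBr addrAC; move: (t - _) r0 r1 => r r0 r1.
  have [rpi|pir] := leP r pi.
    by apply: le_trans (Fge0 r r0); rewrite mulr_ge0_le0// subr_le0.
  apply: (@le_trans _ _ (M * r)); last by rewrite Flow// (ltW pir) ltW.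
  by rewrite ler_wpM2l//; lra.
have F2 (t : R) : pi *+ 2 <= t -> F t = F (t - pi *+ 2) + M * (pi *+ 2).
  by move=> t2; rewrite -(Fn 1) ?subr_ge0// subrK.
have MT (t u : R) : t <= u -> M * t <= M * u by move=> tu; rewrite ler_wpM2l.
have half0 : 0 <= T / 2 by lra.
(* The lower bounds available for [F T] and [F (T / 2)] change at multiples of pi. Up to [2 pi],
   [F T >= M T] alone suffices. *)
have [T2|T2] := leP T (pi *+ 2).
  have := Fge0 (T / 2) half0; have := Flow T; rewrite piT T2 => /(_ isT).
  by move: (F T) (F _) => f1 f2; lra.
have T0 : 0 <= T - pi *+ 2 by lra.
(* The tight range: only [F T >= 2 pi M] is known, while [T / 2] lies where [F (T / 2) >= M T / 2].
   Together they give [3/2 pi M + M T / 4], which reaches [3/4 M T] exactly as long as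
   [T <= 3 pi]. *)
have [T3|T3] := leP T (pi *+ 3).
  have := Flow (T / 2) ltac:(lra); rewrite (F2 T (ltW T2)).
  have := Fge0 _ T0; have := MT _ _ T3.
  by move: (F _) (F (T / 2)) => f1 f2; lra.
have [T4|T4] := leP T (pi *+ 4).
  have := Fge0 (T / 2) half0; rewrite (F2 T (ltW T2)).
  have := Flow (T - pi *+ 2) ltac:(lra).
  by move: (F _) (F (T / 2)) => f1 f2; lra.
(* Removing two periods from [T] and one from [T / 2] leaves [F T >= 4 pi M] and
   [F (T / 2) >= 2 pi M], hence [4 pi M] against at most [15/4 pi M]. *)
have [T5|T5] := leP T (pi *+ 5).
  rewrite (F2 T (ltW T2)) (F2 (T - pi *+ 2) ltac:(lra)) (F2 (T / 2) ltac:(lra)).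
  have := Fge0 (T - pi *+ 2 - pi *+ 2) ltac:(lra).
  have := Fge0 (T / 2 - pi *+ 2) ltac:(lra).
  have := MT _ _ T5.
  have Mpi : 0 <= M * pi by rewrite mulr_ge0// ltW.
  by move: (F _) (F (T / 2 - _)) => f1 f2; lra.
(* The gap bound at [T] and [T / 2] gives [M (T - 5/4 pi)], which is at least [3/4 M T] precisely
   from [T = 5 pi] on; this fixes the last cut point. *)
have := Fgap T ltac:(lra); have := Fgap (T / 2) half0; have := MT _ _ (ltW T5).
by move: (F T) (F _) => f1 f2; lra.
Qed.

End primitive.

(** Integrating from -1 puts 0 strictly inside the domain, so [F] has a two-sided derivative at 0
    too and closed intervals starting at 0 need no special treatment. *)
Lemma continuous_primitive (R : realType) (psi : R -> R) : continuous psi ->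
  exists F : R -> R,
    F 0 = 0 /\ forall t : R, -1 < t -> is_derive t 1 F (psi t).
Proof.
move=> cpsi.
pose P t := (\int[lebesgue_measure]_(s in `[(-1)%R, t]) psi s)%R.
exists (fun t => P t - P 0); split; first by rewrite subrr.
move=> t t1.
have int_psi : lebesgue_measure.-integrable `[-1, t + 1] (EFin \o psi).
  apply: continuous_compact_integrable; first exact: segment_compact.
  by apply: continuous_subspaceT.
have tt1 : t < t + 1 by rewrite ltrDl.
have [dP DP] := continuous_FTC1_closed tt1 int_psi t1 (cpsi t).
have dPt : is_derive t 1 P (psi t).
  by split; [exact: dP|rewrite -derive1E; exact: DP].
have := is_deriveB dPt (is_derive_cst (P 0) t 1).
by rewrite subr0.
Qed.

Lemma continuous_scaled (R : realType) (psi : R -> R) (k : R) :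
  continuous psi -> continuous (fun t : R => psi (t * k)).
Proof.
move=> cpsi t; have ck : {for t, continuous (fun t : R => t * k)}.
  by apply: cvgMl; exact: cvg_id.
exact: (continuous_comp ck (cpsi _)).
Qed.

Section scaled_integral.
Context {R : realType}.
Variables (F psi : R -> R).
Hypothesis F0 : F 0 = 0.
Hypothesis dF : forall t : R, -1 < t -> is_derive t 1 F (psi t).
Hypothesis cpsi : continuous psi.

Lemma integral_scaled (k b : R) : 0 < k -> 0 < b ->
  (\int[lebesgue_measure]_(t in `[0%R, b]) (psi (t * k)%R)%:E =
   (F (k * b) / k)%R%:E)%E.
Proof.
move=> k0 b0.
(* [G] is a primitive of [psi (t * k)]; the summand 0 gives the inner map the shape of
   [is_derive_affine]. *)
pose G t := k^-1 * F (0 + k * t).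
have dG (t : R) : 0 <= t -> is_derive t 1 G (psi (t * k)).
  move=> t0.
  have d1 : is_derive (0 + k * t) 1 F (psi (t * k)).
    rewrite add0r mulrC; apply: dF.
    by apply: (@lt_le_trans _ _ 0); rewrite ?ltrN10 ?mulr_ge0// ltW.
  have := is_deriveZ k^-1
    (@is_derive1_comp _ F (fun t => 0 + k * t) t _ _ d1
      (is_derive_affine 0 k t)).
  by rewrite /GRing.scale/= (mulrC _ k) mulrA mulVf ?gt_eqF// mul1r.
have cG (t : R) : 0 <= t -> {for t, continuous G}.
  move=> /dG [dG' _]; apply: differentiable_continuous.
  by apply/derivable1_diffP.
have := @continuous_FTC2 R (fun t => psi (t * k)) G 0 b b0.
rewrite /G !add0r mulr0 F0 mulr0 sube0 => ->.
- by rewrite mulrC.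
- by apply: continuous_subspaceT; exact: continuous_scaled.
- split.
  + move=> t; rewrite in_itv/= => /andP[t0 _].
    by have [] := dG t (ltW t0).
  + by apply: cvg_at_right_filter; exact: (cG 0).
  + by apply: cvg_at_left_filter; exact: (cG b (ltW b0)).
- move=> t; rewrite in_itv/= => /andP[t0 _].
  by rewrite derive1E; have [_] := dG t (ltW t0).
Qed.

Lemma Rintegral_primitive (b : R) : 0 < b ->
  \int[lebesgue_measure]_(t in `[0, b]) psi t = F b.
Proof.
move=> b0; rewrite /Rintegral; have := integral_scaled ltr01 b0.
rewrite mul1r divr1 => E.
rewrite -[RHS]/(fine (F b)%:E) -E; congr fine; apply: eq_integral => t _.
by rewrite mulr1.
Qed.

End scaled_integral.

(** On [0, 1] the weight is 3/4 plus 1/2 times the indicator of [0, 1/2]. For [g t = psi (t * k)]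
    with [k > 0] the two integrals become [F (k * delta) / k] and [F (k * delta / 2) / k], the two
    terms of the scalar inequality. *)
Lemma integral_Vhat (R : realType) (g : R -> R) (delta : R) : 0 < delta ->
  measurable_fun setT g -> (forall t, 0 <= g t) ->
  (\int[lebesgue_measure]_(t in `[0%R, delta]) (g t * Vhat (t / delta))%R%:E =
   (3 / 4)%R%:E * \int[lebesgue_measure]_(t in `[0%R, delta]) (g t)%:E +
   (1 / 2)%R%:E *
     \int[lebesgue_measure]_(t in `[0%R, (delta / 2)%R]) (g t)%:E)%E.
Proof.
move=> d0 mg g0.
have mE (D : set R) : measurable D -> measurable_fun D (EFin \o g).
  by move=> mD; apply/measurable_EFinP; exact: measurable_funTS.
have half : `[0, delta / 2] `<=` `[0, delta].
  by apply: subset_itvl; rewrite bnd_simp; lra.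
rewrite (_ : \int[_]_(t in _) _ = \int[lebesgue_measure]_(t in `[0%R, delta])
    ((3 / 4)%R%:E * (g t)%:E +
     (1 / 2)%R%:E * ((EFin \o g) \_ `[0%R, (delta / 2)%R]) t))%E; last first.
  apply: eq_integral => t; rewrite inE/= in_itv/= => /andP[t0 td].
  rewrite patchE mem_setE in_itv/= t0/= /Vhat ler_pdivrMr//.
  rewrite (_ : 1 / 2 * delta = delta / 2); last by rewrite mulrC mul1r.
  case: ifPn => _.
    by rewrite -!EFinM -EFinD; congr EFin; field.
  by rewrite mule0 adde0 -EFinM; congr EFin; rewrite mulrC.
have pE (t : R) : (0 <= (g t)%:E)%E by rewrite lee_fin.
have pD (t : R) : (0 <= ((EFin \o g) \_ `[0%R, (delta / 2)%R]) t)%E.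
  by apply: erestrict_ge0 => u _; exact: pE.
have mD : measurable_fun `[0, delta] ((EFin \o g) \_ `[0%R, (delta / 2)%R]).
  by apply/measurable_restrict => //; apply: mE; exact: measurableI.
rewrite ge0_integralD//=; last 4 first.
- by move=> t _; rewrite mule_ge0// lee_fin.
- by apply: measurable_funeM; exact: mE.
- by move=> t _; rewrite mule_ge0// lee_fin.
- exact: measurable_funeM.
rewrite ge0_integralZl_EFin//; last by exact: mE.
rewrite ge0_integralZl_EFin//.
by rewrite -integral_mkcondr setIC (setIidl half).
Qed.

Section symbol_mean.
Context {R : realType}.
Variable psi : R -> R.
Hypothesis Ppsi : Psi psi.

Lemma Psi_primitive : exists F : R -> R, [/\
  F 0 = 0, forall t : R, -1 < t -> is_derive t 1 F (psi t),
  mean_value psi = pi^-1 * F pi,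
  0 < F pi &
  forall T : R, pi <= T ->
    3 / 4 * mean_value psi * T <= 3 / 4 * F T + 1 / 2 * F (T / 2)].
Proof.
have [[cpsi psi0 per nd _] _ refl av] := Ppsi.
have [F [F0 dF]] := continuous_primitive cpsi.
have pi0 : 0 < pi :> R := pi_gt0 R.
have F2 : F (2 * pi) = F pi *+ 2.
  have pp : 0 <= (pi : R) <= pi by rewrite lexx (ltW pi0).
  have := primitive_refl dF refl pp.
  by rewrite subrr F0 addr0 => <-; rewrite mulr_natl -mulr2n.
have ME : mean_value psi = pi^-1 * F pi.
  rewrite /mean_value (Rintegral_primitive F0 dF cpsi) ?mulr_gt0// F2.
  have piN0 : pi != 0 :> R by rewrite gt_eqF.
  by move: (F pi) (pi : R) piN0 => f p p0; field.
have Fav (t : R) : 0 < t < pi -> t^-1 * F t <= pi^-1 * F pi.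
  move=> t0; have := av t t0; rewrite !(Rintegral_primitive F0 dF cpsi)//.
  by case/andP: t0.
have homoF := primitive_homo dF psi0.
exists F; split => //; last first.
  by rewrite ME; apply: primitive_lower.
(* Positivity of [F pi] rests on the nowhere dense zero set. If [F pi = 0], then [F (2 pi) = 0], so
   by monotonicity [F], and with it its derivative [psi], vanishes on ]0, 2 pi[, making pi an
   interior point of the closed zero set. *)
rewrite lt_def -{2}F0 homoF ?(ltW pi0)// andbT; apply/eqP => Fpi.
have F_eq0 (t : R) : t \in `]0, 2 * pi[ -> F t = 0.
  rewrite in_itv/= => /andP[t0 t2]; apply/eqP; rewrite eq_le.
  rewrite -{2}F0 homoF ?(ltW t0)// andbT.
  by have := homoF t (2 * pi) (ltW t0) (ltW t2); rewrite F2 Fpi mul0rn.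
have psi_eq0 (t : R) : t \in `]0, 2 * pi[ -> psi t = 0.
  move=> t02; have t1 : -1 < t.
    by apply: lt_trans (_ : 0 < t); rewrite ?ltrN10//; case/andP: t02.
  have [_ <-] := dF t t1.
  rewrite (@near_eq_derive _ _ _ F (cst 0)) ?derive_cst//.
  near=> u; apply: F_eq0; near: u; exact: near_in_itvoo.
have : (closure [set t | psi t = 0])° (pi : R).
  apply: filterS (near_in_itvoo (_ : pi \in `]0, 2 * pi[)).
    by move=> u /psi_eq0 ?; exact: subset_closure.
  by rewrite in_itv/= pi0/= mulr_natl mulr2n ltrDl.
by rewrite nd.
Unshelve. all: end_near. Qed.

(** Here [k] is a spectral point. Evenness replaces it by [|k|], and multiplying by [|k|] turns the
    claim into the scalar inequality at [T = |k| * delta]. *)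
Lemma symbol_weight_lower (k delta : R) : 0 < delta -> pi <= `|k| * delta ->
  ((delta * (3 / 4 * mean_value psi))%R%:E <=
   \int[lebesgue_measure]_(t in `[0%R, delta])
     (psi (t * k) * Vhat (t / delta))%R%:E)%E.
Proof.
move=> d0 pik.
have [[cpsi psi0 _ _ _] even _ _] := Ppsi.
have pi0 : 0 < pi :> R := pi_gt0 R.
have k0 : 0 < `|k|.
  by rewrite -(pmulr_lgt0 _ d0) (lt_le_trans pi0).
have [F [F0 dF _ _ lowF]] := Psi_primitive.
have evk (t : R) : psi (t * k) = psi (t * `|k|).
  have [k0'|k0'] := leP 0 k; first by rewrite ger0_norm.
  by rewrite ltr0_norm// mulrN even.
have mpsi : measurable_fun setT (fun t : R => psi (t * `|k|)).
  by apply: continuous_measurable_fun; exact: continuous_scaled.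
have d20 : 0 < delta / 2 by rewrite divr_gt0.
under eq_integral do rewrite evk.
rewrite integral_Vhat//.
rewrite !(integral_scaled F0 dF cpsi)// -!EFinM -EFinD lee_fin.
rewrite -(ler_pM2l k0).
have -> : `|k| * (delta / 2) = `|k| * delta / 2 by rewrite mulrA.
move: (lowF _ pik); move: (mean_value psi) (F _) (F _) => M f1 f2 H.
have -> : `|k| * (delta * (3 / 4 * M)) = 3 / 4 * M * (`|k| * delta) by ring.
apply: le_trans H _; rewrite le_eqVlt; apply/orP; left; apply/eqP.
by field; rewrite gt_eqF.
Qed.

End symbol_mean.

Local Open Scope complex_scope.

(** * Norms and projections *)

Section rnorm_theory.
Context {R : realType} {V : normedZmodType R[i]}.
Implicit Types x y : V.

Lemma rnormE x : `|x| = (rnorm x)%:C.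
Proof. by rewrite /rnorm RRe_real// normr_real. Qed.

Lemma rnorm_ge0 x : 0 <= rnorm x.
Proof. by rewrite -ler0c -rnormE. Qed.

Lemma rnorm0 : rnorm (0 : V) = 0.
Proof. by apply: complexI; rewrite -rnormE normr0. Qed.

Lemma rnorm0_eq0 x : rnorm x = 0 -> x = 0.
Proof. by move=> x0; apply/eqP; rewrite -normr_eq0 rnormE x0. Qed.

Lemma rnormN x : rnorm (- x) = rnorm x.
Proof. by rewrite /rnorm normrN. Qed.

Lemma rnorm_distC x y : rnorm (x - y) = rnorm (y - x).
Proof. by rewrite -rnormN opprB. Qed.

Lemma ler_rnormD x y : rnorm (x + y) <= rnorm x + rnorm y.
Proof. by rewrite -lecR rmorphD/= -!rnormE ler_normD. Qed.

Lemma ler_rdistD (z x y : V) : rnorm (x - y) <= rnorm (x - z) + rnorm (z - y).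
Proof. by rewrite -[x - y](subrKA z) ler_rnormD. Qed.

Lemma ler_rnorm_dist x y : `|rnorm x - rnorm y| <= rnorm (x - y).
Proof.
rewrite ler_norml lerBlDr lerNl opprB lerBlDr; apply/andP; split.
  by rewrite rnorm_distC -{1}(subrK x y) ler_rnormD.
by rewrite -{1}(subrK y x) ler_rnormD.
Qed.

End rnorm_theory.

Lemma rnorm_real (R : realType) (a : R) : rnorm (a%:C : R[i]) = `|a|.
Proof. by rewrite /rnorm normc_def /= expr0n addr0 sqrtr_sqr. Qed.

Lemma rnorm_ReIm (R : realType) (z : R[i]) :
  rnorm z <= `|complex.Re z| + `|complex.Im z|.
Proof.
rewrite /rnorm normc_def /= -[leRHS]ger0_norm ?addr_ge0// -sqrtr_sqr.
rewrite ler_wsqrtr// sqrrD !real_normK ?num_real// lerD2r lerDl.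
by rewrite mulrn_wge0// mulr_ge0.
Qed.

Lemma rnorm_sqrE (R : realType) (z : R[i]) :
  rnorm z ^+ 2 = complex.Re z ^+ 2 + complex.Im z ^+ 2.
Proof. by rewrite /rnorm normc_def /= sqr_sqrtr// addr_ge0// sqr_ge0. Qed.

Lemma ler_Re_rnorm (R : realType) (z : R[i]) : `|complex.Re z| <= rnorm z.
Proof. by rewrite -lecR -rnormE normc_ge_Re. Qed.

Lemma ler_Im_rnorm (R : realType) (z : R[i]) : `|complex.Im z| <= rnorm z.
Proof.
rewrite -[leLHS]ger0_norm// -ler_sqr ?nnegrE ?rnorm_ge0//.
by rewrite rnorm_sqrE normr_id real_normK ?num_real// lerDr sqr_ge0.
Qed.


Section rnorm_cvg.
Context {R : realType} {V : normedModType R[i]}.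

(** A positive element of [R[i]] has zero imaginary part, so the complex radii of the normed module
    are just the positive reals. *)
Lemma rnorm_cvgP {T : Type} {F : set_system T} {FF : Filter F}
    (u : T -> V) (l : V) : u @ F --> l <->
  forall e : R, 0 < e -> \forall n \near F, rnorm (l - u n) < e.
Proof.
split=> [/cvgrPdist_lt ul e e0|ul].
  have : 0 < e%:C by rewrite ltcR.
  by move=> /ul; apply: filterS => n; rewrite rnormE ltcR.
apply/cvgrPdist_lt => -[a b]; rewrite ltcE/= => /andP[/eqP -> a0].
by apply: filterS (ul a a0) => n; rewrite rnormE ltcR.
Qed.

Lemma cvg_rnorm (u : nat -> V) (l : V) :
  u @ \oo --> l -> (fun n => rnorm (u n)) @ \oo --> rnorm l.
Proof.
move=> /rnorm_cvgP ul; apply/cvgrPdist_lt => e e0.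
apply: filterS (ul e e0) => n; apply: le_lt_trans; exact: ler_rnorm_dist.
Qed.

End rnorm_cvg.

Section hilbert.
Context {R : realType} {H : completeNormedModType R[i]}.
Variable dot : {dot H for @Num.conj R[i]}.
Hypothesis dot_norm : forall x : H, `|x| ^+ 2 = dot x x.

Lemma rnorm_sqr x : (rnorm x ^+ 2)%:C = dot x x.
Proof. by rewrite -dot_norm rnormE rmorphXn. Qed.

Lemma rnorm_pythagoras x y :
  dot x y = 0 -> rnorm (x + y) ^+ 2 = rnorm x ^+ 2 + rnorm y ^+ 2.
Proof.
by move=> xy; apply: complexI; rewrite rmorphD/= !rnorm_sqr hnormDd.
Qed.

Lemma rnormZ_sqr (a : R[i]) (x : H) :
  rnorm (a *: x) ^+ 2 = rnorm a ^+ 2 * rnorm x ^+ 2.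
Proof.
rewrite -exprMn; congr (_ ^+ 2); apply: complexI.
by rewrite rmorphM/= -!rnormE normrZ.
Qed.

Lemma dot_sumr (I : eqType) (r : seq I) (x : H) (f : I -> H) :
  (forall i, i \in r -> dot x (f i) = 0) -> dot x (\sum_(i <- r) f i) = 0.
Proof.
by move=> xf; rewrite linear_sumr big_seq big1// => i /xf.
Qed.

Lemma rnorm_pythagoras_sum (I : eqType) (r : seq I) (f : I -> H) : uniq r ->
  {in r &, forall i j, i != j -> dot (f i) (f j) = 0} ->
  rnorm (\sum_(i <- r) f i) ^+ 2 = \sum_(i <- r) rnorm (f i) ^+ 2.
Proof.
elim: r => [|i r IH]; first by rewrite !big_nil rnorm0 expr0n.
rewrite cons_uniq => /andP[ir ur] orth; rewrite !big_cons rnorm_pythagoras.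
  congr (_ + _); apply: IH => // j k jr kr.
  by apply: orth; rewrite inE ?jr ?kr orbT.
apply: dot_sumr => j jr; apply: orth; rewrite ?inE ?eqxx ?jr ?orbT//.
by apply: contraNneq ir => ->.
Qed.

Variable E : set R -> H -> H.
Hypothesis E_res : resolution_of_identity dot E.

Lemma roi_linear B : measurable B -> linear (E B).
Proof. by move=> mB; have [] := roi_proj E_res mB. Qed.

Lemma roi_idem B x : measurable B -> E B (E B x) = E B x.
Proof. by move=> mB; have [_ ->] := roi_proj E_res mB. Qed.

Lemma roi_adj B x y : measurable B -> dot (E B x) y = dot x (E B y).
Proof. by move=> mB; have [_ _ ->] := roi_proj E_res mB. Qed.

Lemma roiD B x y : measurable B -> E B (x + y) = E B x + E B y.
Proof. by move=> mB; have := roi_linear mB 1 x y; rewrite !scale1r. Qed.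

Lemma roi0 B : measurable B -> E B 0 = 0.
Proof.
by move=> mB; have /eqP := roiD 0 0 mB; rewrite addr0 -subr_eq subrr => /eqP.
Qed.

(** Finite additivity: the pair is padded with empty sets, and the partial sums are constant from
    index 2 on. *)
Lemma roiU A B x : measurable A -> measurable B -> A `&` B = set0 ->
  E (A `|` B) x = E A x + E B x.
Proof.
move=> mA mB AB.
have mC j : measurable (bigcup2 A B j) by case: j => [|[|j]]//=.
have tC : trivIset setT (bigcup2 A B) by rewrite -trivIset_bigcup2.
have := @roi_sigma_additive _ _ _ _ E_res _ x mC tC.
rewrite bigcup2E => cvE; apply: (cvg_unique (@norm_hausdorff _ _) cvE).
apply: cvg_near_cst; exists 2%N => // -[|[|n]]//= _.
rewrite /series/= big_nat_recl// big_nat_recl//= big1 ?addr0// => i _.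
by rewrite /= (roi_set0 E_res).
Qed.

(* [E A + E B = E (A `|` B)] is idempotent, so the cross terms cancel. *)
Lemma roi_comp_eq0 A B x : measurable A -> measurable B -> A `&` B = set0 ->
  E A (E B x) = 0.
Proof.
move=> mA mB AB; set z := E B x; have Bz : E B z = z by exact: roi_idem.
have mAB : measurable (A `|` B) by exact: measurableU.
have PE y : E (A `|` B) y = E A y + E B y by exact: roiU.
clearbody z; have := roi_idem z mAB.
rewrite (PE z) Bz roiD// !PE Bz roi_idem// => /eqP.
rewrite -[X in _ == X]add0r (inj_eq (addIr _)) => /eqP ABA.
(* At this point [E A z + E B (E A z) = 0]. Applying [E B] doubles the second term, so it is zero,
   and then so is [E A z]. *)
have := congr1 (E B) ABA; rewrite roi0// roiD// roi_idem// -mulr2n -scaler_nat.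
move/eqP; rewrite scaler_eq0 pnatr_eq0/= => /eqP BA.
by move: ABA; rewrite BA addr0.
Qed.

Lemma roi_orth A B x y : measurable A -> measurable B -> A `&` B = set0 ->
  dot (E A x) (E B y) = 0.
Proof. by move=> mA mB AB; rewrite roi_adj// roi_comp_eq0// linear0r. Qed.

End hilbert.

(* The unused proof arguments allow the measure structure to be inferred. *)
Definition spectral_mass (R : realType) (H : completeNormedModType R[i])
    (dot : {dot H for @Num.conj R[i]}) (E : set R -> H -> H)
    (_ : forall x : H, `|x| ^+ 2 = dot x x) (_ : resolution_of_identity dot E)
    (x : H) (B : set R) : \bar R := (rnorm (E B x) ^+ 2)%:E.

Section spectral_mass.
Context {R : realType} {H : completeNormedModType R[i]}.
Context {dot : {dot H for @Num.conj R[i]}} {E : set R -> H -> H}.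
Variables (dot_norm : forall x : H, `|x| ^+ 2 = dot x x)
  (E_res : resolution_of_identity dot E) (x : H).
Local Notation mu := (spectral_mass dot_norm E_res x).

Let spectral_mass0 : mu set0 = 0%E.
Proof. by rewrite /spectral_mass (roi_set0 E_res) rnorm0 expr0n. Qed.

Let spectral_mass_ge0 B : (0 <= mu B)%E.
Proof. by rewrite lee_fin sqr_ge0. Qed.

(** The vector series converges in norm, so the squared norms of its partial sums converge; by
    Pythagoras these are the partial sums of the masses. *)
Let spectral_mass_sigma_additive : semi_sigma_additive mu.
Proof.
move=> F mF tF mUF.
have := cvg_rnorm (@roi_sigma_additive _ _ _ _ E_res _ x mF tF).
move=> /(fun h => cvgM h h) h.
rewrite (_ : (fun n => _) = (fun n =>
    (rnorm (series (fun j => E (F j) x) n) *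
     rnorm (series (fun j => E (F j) x) n))%:E)).
  by rewrite /spectral_mass expr2; apply: cvg_EFin h; exact: nearW.
apply/funext => n; rewrite sumEFin/= -expr2 /series/=.
rewrite (rnorm_pythagoras_sum dot_norm) ?iota_uniq// => i j _ _ ij.
have Fij : F i `&` F j = set0 by move: tF => /trivIsetP; apply.
exact: (roi_orth E_res x x (mF i) (mF j) Fij).
Qed.

HB.instance Definition _ := isMeasure.Build _ _ _ mu
  spectral_mass0 spectral_mass_ge0 spectral_mass_sigma_additive.

Let spectral_mass_fin : fin_num_fun mu.
Proof. by []. Qed.

HB.instance Definition _ := Measure_isFinite.Build _ _ _ mu spectral_mass_fin.

End spectral_mass.

(** * Spectral integrals of simple and of bounded functions *)

Section simple_spectral_integral.
Context {R : realType} {H : completeNormedModType R[i]}.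
Context {dot : {dot H for @Num.conj R[i]}} {E : set R -> H -> H}.
Variables (dot_norm : forall x : H, `|x| ^+ 2 = dot x x)
  (E_res : resolution_of_identity dot E) (x : H).
Local Notation mu := (spectral_mass dot_norm E_res x).
Local Notation S s := (simple_spectral_integral E s x).
Implicit Types (s : {fimfun R >-> R[i]}) (A : set R).

Lemma roi_sum_preimage (T : choiceType) (g : R -> T) (l : seq T) A :
  (forall c, measurable (g @^-1` [set c])) -> measurable A -> uniq l ->
  (forall t, g t \in l) -> E A x = \sum_(c <- l) E (A `&` g @^-1` [set c]) x.
Proof.
move=> mg mA ul gl.
(* The covering hypothesis on [l] is lost when a value is dropped, so the induction runs on the part
   of [A] where [g] takes values in [l]. *)
suff {gl} : measurable (A `&` g @^-1` [set` l]) /\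
    E (A `&` g @^-1` [set` l]) x = \sum_(c <- l) E (A `&` g @^-1` [set c]) x.
  by move=> [_ <-]; rewrite (_ : _ @^-1` _ = setT) ?setIT// -subTset => t _ /=.
elim: l ul => [_|c l IH /= /andP[cl /IH[ml El]]].
  rewrite big_nil (_ : _ @^-1` _ = set0); last by rewrite -subset0 => t.
  by rewrite setI0 (roi_set0 E_res).
have -> : A `&` g @^-1` [set` c :: l] =
    (A `&` g @^-1` [set c]) `|` (A `&` g @^-1` [set` l]).
  rewrite -setIUr; congr (_ `&` _); apply/seteqP; split => t /=.
    by rewrite inE => /predU1P[|]; [left|right].
  by rewrite inE => -[->|->]; rewrite ?eqxx ?orbT.
have mc : measurable (A `&` g @^-1` [set c]) by exact: measurableI.
split; first exact: measurableU.
rewrite big_cons -El (roiU E_res)//.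
rewrite -subset0 => t /= [[_ tc] [_]]; rewrite tc => cl'.
by rewrite cl' in cl.
Qed.

Lemma simple_spectral_integralE s (l : seq R[i]) :
  uniq l -> (forall t, s t \in l) ->
  S s = \sum_(c <- l) c *: E (s @^-1` [set c]) x.
Proof.
move=> ul sl; rewrite /simple_spectral_integral; apply: fsbig_fwiden => //.
  by move=> _ [t _ <-] /=.
move=> c /= [_ cl]; rewrite (_ : _ @^-1` _ = set0) ?(roi_set0 E_res) ?scaler0//.
by rewrite -subset0 => t /= tc; apply: cl; exists t.
Qed.

Definition fimfun_values s : seq R[i] :=
  finmap.enum_fset (fset_set (range s)).

Lemma fimfun_values_uniq s : uniq (fimfun_values s).
Proof. exact: finmap.fset_uniq. Qed.

Lemma mem_fimfun_values s t : s t \in fimfun_values s.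
Proof. by rewrite /fimfun_values in_fset_set// inE; exists t. Qed.

Hint Resolve fimfun_values_uniq mem_fimfun_values : core.

Section difference.
Variables s s' : {fimfun R >-> R[i]}.
Hypotheses (ms : forall c, measurable (s @^-1` [set c]))
  (ms' : forall c, measurable (s' @^-1` [set c])).

Let L := [seq (c, c') | c <- fimfun_values s, c' <- fimfun_values s'].
Let D (p : R[i] * R[i]) := s @^-1` [set p.1] `&` s' @^-1` [set p.2].

Let mD p : measurable (D p). Proof. exact: measurableI. Qed.

Let uL : uniq L.
Proof. by apply: allpairs_uniq => // -[? ?] [? ?]. Qed.

Let D_disj p q : p != q -> D p `&` D q = set0.
Proof.
move=> /eqP pq; rewrite -subset0 => t [[p1 p2] [q1 q2]]; apply: pq.
by case: p q p1 p2 q1 q2 => [a b] [c d] /= <- <- <- <-.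
Qed.

Lemma simple_spectral_integral_split (g : R[i] * R[i] -> R[i]) :
  rnorm (\sum_(p <- L) g p *: E (D p) x) ^+ 2 =
  \sum_(p <- L) rnorm (g p) ^+ 2 * rnorm (E (D p) x) ^+ 2.
Proof.
rewrite (rnorm_pythagoras_sum dot_norm)//; last first.
  move=> p q _ _ pq; rewrite linearZl_LR/= linearZr_LR/=.
  by rewrite (roi_orth E_res x x (mD p) (mD q) (D_disj pq)) !mulr0.
by apply: eq_bigr => p _; rewrite rnormZ_sqr.
Qed.

(* [D] is the common refinement of the level sets of [s] and [s']. *)
Lemma simple_spectral_integralB :
  S s - S s' = \sum_(p <- L) (p.1 - p.2) *: E (D p) x.
Proof.
under [RHS]eq_bigr do rewrite scalerBl; rewrite sumrB; congr (_ - _).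
  rewrite /L big_allpairs/= (@simple_spectral_integralE _ (fimfun_values s))//.
  apply: eq_bigr => c _; rewrite -scaler_sumr; congr (_ *: _).
  exact: roi_sum_preimage.
rewrite /L big_allpairs/= exchange_big/=.
rewrite (@simple_spectral_integralE _ (fimfun_values s'))//.
apply: eq_bigr => c _; rewrite -scaler_sumr; congr (_ *: _).
rewrite (@roi_sum_preimage _ s (fimfun_values s))//.
by apply: eq_bigr => c' _; rewrite /D setIC.
Qed.

(** Both [S s - S s'] and [x] itself (all coefficients 1) are orthogonal sums over the cells of the
    common refinement, so squared norms compare cell by cell. A nonempty cell contains a point where
    [s - s'] equals [p.1 - p.2]; an empty one contributes 0. Existence and uniqueness of spectral
    integrals both rest on this bound. *)
Lemma simple_spectral_integral_dist (M : R) :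
  (forall t, rnorm (s t - s' t) <= M) -> rnorm (S s - S s') <= M * rnorm x.
Proof.
move=> sM; have M0 : 0 <= M by apply: le_trans (sM 0); exact: rnorm_ge0.
rewrite -(@ler_pXn2r _ 2)// ?nnegrE ?mulr_ge0 ?rnorm_ge0//.
rewrite simple_spectral_integralB simple_spectral_integral_split exprMn.
have xE : x = \sum_(p <- L) 1 *: E (D p) x.
  under eq_bigr do rewrite scale1r.
  rewrite /L big_allpairs/= -[LHS](roi_setT E_res).
  rewrite (@roi_sum_preimage _ s (fimfun_values s))//; apply: eq_bigr => c _.
  by rewrite setTI; exact: roi_sum_preimage.
rewrite [in leRHS]xE simple_spectral_integral_split mulr_sumr.
have r1 : rnorm (1 : R[i]) = 1 by rewrite -[1]/(1%:C) rnorm_real normr1.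
apply: ler_sum => p _; rewrite r1 expr1n mul1r.
have [->|/set0P[t [t1 t2]]] := eqVneq (D p) set0.
  by rewrite (roi_set0 E_res) rnorm0 expr0n !mulr0.
rewrite ler_wpM2r ?sqr_ge0// ler_pXn2r ?nnegrE ?rnorm_ge0//.
by rewrite -t1 -t2.
Qed.

End difference.

Lemma rnorm_fimfunE s t : (rnorm (s t) ^+ 2)%:E =
  (\sum_(c <- fimfun_values s)
     (rnorm c ^+ 2)%:E * (\1_(s @^-1` [set c]) t)%:E)%E.
Proof.
rewrite (bigD1_seq (s t)) ?mem_fimfun_values ?fimfun_values_uniq//= big1 ?adde0.
  by rewrite indicE mem_set// mule1.
move=> c /eqP sc; rewrite indicE memNset ?mule0// => /= tc; exact: sc.
Qed.

Lemma measurable_rnorm_fimfun s : (forall c, measurable (s @^-1` [set c])) ->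
  measurable_fun setT (fun t => (rnorm (s t) ^+ 2)%:E).
Proof.
move=> ms; under eq_fun do rewrite rnorm_fimfunE.
apply: emeasurable_sum => c; apply: measurable_funeM; apply/measurable_EFinP.
exact: measurable_indic.
Qed.

Lemma simple_spectral_integral_norm s :
  (forall c, measurable (s @^-1` [set c])) ->
  ((rnorm (S s) ^+ 2)%:E = \int[mu]_t (rnorm (s t) ^+ 2)%:E)%E.
Proof.
move=> ms; set l := fimfun_values s.
transitivity (\sum_(c <- l) (rnorm c ^+ 2)%:E * mu (s @^-1` [set c]))%E.
  under eq_bigr do rewrite /spectral_mass -EFinM.
  rewrite sumEFin; congr EFin.
  rewrite (@simple_spectral_integralE _ l)//; last exact: fimfun_values_uniq.
  rewrite (rnorm_pythagoras_sum dot_norm) ?fimfun_values_uniq//.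
    by apply: eq_bigr => c _; rewrite rnormZ_sqr.
  move=> c c' _ _ cc'; rewrite linearZl_LR/= linearZr_LR/=.
  have disj : s @^-1` [set c] `&` s @^-1` [set c'] = set0.
    by rewrite -subset0 => t /= [tc tc']; move/eqP: cc'; apply; rewrite -tc.
  by rewrite (roi_orth E_res x x (ms c) (ms c') disj) !mulr0.
under eq_integral => t _.
  rewrite rnorm_fimfunE.
  over.
rewrite ge0_integral_sum//; last 2 first.
- move=> c; apply: measurable_funeM; apply/measurable_EFinP.
  exact: measurable_indic.
- by move=> c t _; rewrite mule_ge0// lee_fin ?sqr_ge0.
apply: eq_bigr => c _; rewrite ge0_integralZl_EFin ?sqr_ge0//.
- by rewrite integral_indic// setIT.
- by apply/measurable_EFinP; exact: measurable_indic.
Qed.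

End simple_spectral_integral.

Lemma uniform_rnormP (R : realType) (s : nat -> R -> R[i]) (f : R -> R[i]) :
  {uniform, (fun n => (s n : R -> R[i]^o)) @ \oo --> (f : R -> R[i]^o)} <->
  forall e : R, 0 < e -> \forall n \near \oo, forall t, rnorm (f t - s n t) < e.
Proof.
split=> [sf e e0|sf P].
  have e0C : 0 < e%:C :> R[i] by rewrite ltcR.
  pose A := [set h : R -> R[i]^o | forall y, [set: R] y ->
    [set xy : R[i]^o * R[i]^o | ball xy.1 (PosNum e0C)%:num xy.2] (f y, h y)].
  have nA : nbhs (f : {uniform` [set: R] -> R[i]^o}) A.
    apply/uniform_nbhs.
    exists [set xy : R[i]^o * R[i]^o | ball xy.1 (PosNum e0C)%:num xy.2].
    by split; [exact: entourage_ball|].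
  near=> n => t; have An : A (s n) by near: n; exact: sf.
  by have := An t Logic.I; rewrite /= -ball_normE /= rnormE ltcR.
move=> /uniform_nbhs[B [+ BP]]; rewrite -entourage_from_ballE => -[[a b]].
rewrite /= ltcE/= => /andP[/eqP -> a0] aB.
apply: filterS (sf a a0) => n Hn; apply: BP => t _; apply: aB => /=.
by rewrite -ball_normE /= rnormE ltcR.
Unshelve. all: end_near. Qed.

Section spectral_integral.
Context {R : realType} {H : completeNormedModType R[i]}.
Context {dot : {dot H for @Num.conj R[i]}} {E : set R -> H -> H}.
Variables (dot_norm : forall x : H, `|x| ^+ 2 = dot x x)
  (E_res : resolution_of_identity dot E) (x : H).
Local Notation mu := (spectral_mass dot_norm E_res x).
Local Notation S s := (simple_spectral_integral E s x).

Lemma is_spectral_integral_unique (D : set R) (f : R -> R[i]) (v w : H) :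
  is_spectral_integral E D f x v -> is_spectral_integral E D f x w -> v = w.
Proof.
move=> [s [ms /uniform_rnormP sf /rnorm_cvgP sv]].
move=> [r [mr /uniform_rnormP rf /rnorm_cvgP rw]].
apply/eqP; rewrite -subr_eq0; apply/eqP/rnorm0_eq0/eqP.
rewrite eq_le rnorm_ge0 andbT; apply/ler_addgt0Pl => e e0; rewrite addr0.
(* [v] and [w] each cost [e / k], and the two simple integrals differ by at most [2 (e / k) |x|],
   which adds up to [e]. The summand 2 keeps [k] positive for [x = 0]. *)
pose k := 2 + 2 * rnorm x.
have k0 : 0 < k by rewrite /k ltr_pwDl// mulr_ge0 ?rnorm_ge0.
have ek : 0 < e / k by rewrite divr_gt0.
near \oo => n.
have h1 : rnorm (v - S (s n)) < e / k by near: n; exact: sv.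
have h2 : rnorm (w - S (r n)) < e / k by near: n; exact: rw.
have a1 : forall t, rnorm ((\1_D t * f t) - s n t) < e / k.
  by near: n; exact: sf.
have a2 : forall t, rnorm ((\1_D t * f t) - r n t) < e / k.
  by near: n; exact: rf.
have h3 : rnorm (S (s n) - S (r n)) <= (e / k + e / k) * rnorm x.
  apply: (simple_spectral_integral_dist dot_norm E_res x) => [||t].
  - exact: ms.
  - exact: mr.
  apply: le_trans (ler_rdistD (\1_D t * f t) _ _) _.
  by rewrite lerD// ltW// rnorm_distC.
apply: le_trans (ler_rdistD (S (s n)) _ _) _.
apply: le_trans (lerD (ltW h1) (ler_rdistD (S (r n)) _ _)) _.
rewrite (rnorm_distC _ w); apply: le_trans (lerD (lexx _) (lerD h3 (ltW h2))) _.
rewrite le_eqVlt; apply/orP; left; apply/eqP.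
by rewrite /k; field; rewrite gt_eqF.
Unshelve. all: end_near. Qed.

Lemma spectral_integralP (D : set R) (f : R -> R[i]) (v : H) :
  is_spectral_integral E D f x v -> spectral_integral E D f x = v.
Proof.
move=> fv; apply: (is_spectral_integral_unique _ fv).
by rewrite /spectral_integral; case: xgetP => [w -> //|/(_ v)].
Qed.

Lemma spectral_integral1 (D : set R) : measurable D ->
  spectral_integral E D (cst 1) x = E D x.
Proof.
move=> mD; apply: spectral_integralP.
exists (fun=> indic_fimfun D); split.
- move=> _ c; rewrite /indic_fimfun/=.
  rewrite preimage_indic; case: ifPn => _; case: ifPn => _ //.
  exact: measurableC.
- apply/uniform_rnormP => e e0; apply: nearW => n t.
  by rewrite mulr1 subrr rnorm0.
- rewrite (_ : (fun=> _) = fun=> E D x); first exact: cvg_cst.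
  apply/funext => n.
  rewrite (@simple_spectral_integralE _ _ _ _ E_res _ _ [:: 1; 0]).
  + rewrite !big_cons big_nil scale1r scale0r !addr0; congr (E _ x).
    apply/seteqP; split => t /=; rewrite indicE.
      case: (boolP (t \in D)) => [/set_mem//|_ /eqP].
      by rewrite eq_sym oner_eq0.
    by move=> tD; rewrite mem_set.
  + by rewrite /= inE oner_eq0.
  + by move=> t; rewrite /= indicE !inE; case: (_ \in _); rewrite eqxx ?orbT.
Qed.

Lemma is_spectral_integral_exists (D : set R) (f : R -> R[i]) :
  (forall e : R, 0 < e -> exists2 s : {fimfun R >-> R[i]},
    (forall c, measurable (s @^-1` [set c])) &
    forall t, rnorm ((\1_D t * f t) - s t) < e) ->
  exists v, is_spectral_integral E D f x v.
Proof.
move=> approx; pose e n : R := n.+1%:R^-1.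
have e0 n : 0 < e n by rewrite invr_gt0 ltr0n.
have /choice[s Hs] n : exists s : {fimfun R >-> R[i]},
    (forall c, measurable (s @^-1` [set c])) /\
    forall t, rnorm ((\1_D t * f t) - s t) < e n.
  by have [s ? ?] := approx (e n) (e0 n); exists s.
have sf (d : R) : 0 < d ->
    \forall n \near \oo, forall t, rnorm ((\1_D t * f t) - s n t) < d.
  move=> d0; have := near_infty_natSinv_lt (PosNum d0).
  apply: filterS => n nd t; apply: lt_trans nd; exact: (Hs n).2.
have : cvg ((fun n => S (s n)) @ \oo).
  apply: cauchy_cvg; apply/cauchyP => -[a b].
  rewrite ltcE/= => /andP[/eqP -> a0].
  (* Two simple functions within [d] of the integrand have integrals at distance at most
     [2 d |x| = a |x| / (1 + |x|) < a]. *)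
  pose d := a / (2 * (1 + rnorm x)).
  have x1 : 0 < 1 + rnorm x by rewrite ltr_pwDl// rnorm_ge0.
  have d0 : 0 < d by rewrite divr_gt0// mulr_gt0.
  have [m _ /(_ m (leqnn m)) a2] := sf d d0.
  exists (S (s m)); near=> n => /=; rewrite -ball_normE /= rnormE ltcR.
  have a1 : forall t, rnorm ((\1_D t * f t) - s n t) < d by near: n; exact: sf.
  apply: (@le_lt_trans _ _ ((d + d) * rnorm x)).
    apply: (simple_spectral_integral_dist dot_norm E_res x) => [||t].
    - exact: (Hs m).1.
    - exact: (Hs n).1.
    apply: le_trans (ler_rdistD (\1_D t * f t) _ _) _.
    by rewrite lerD// ltW// rnorm_distC.
  have -> : d + d = a / (1 + rnorm x) by rewrite /d; field; rewrite gt_eqF.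
  rewrite mulrAC ltr_pdivrMr// ltr_pM2l// ltrDr//.
move=> /cvg_ex[v sv]; exists v, s; split => //.
- by move=> n; exact: (Hs n).1.
- exact/uniform_rnormP.
Unshelve. all: end_near. Qed.

End spectral_integral.

Lemma finite_set_int_le (m : nat) : finite_set [set z : int | `|z| <= m%:Z].
Proof.
apply: (@sub_finite_set _ _ [set` [seq k%:Z - m%:Z | k <- iota 0 (m + m).+1]]).
  move=> z /=; rewrite ler_norml => /andP[mz zm].
  have zm0 : 0 <= z + m%:Z by rewrite -lerBlDr sub0r.
  suff : z \in [seq k%:Z - m%:Z | k <- iota 0 (m + m).+1] by [].
  apply/mapP; exists (absz (z + m%:Z)); last first.
    by rewrite gez0_abs ?addrK.
  by rewrite mem_iota add0n leq0n/= ltnS -lez_nat PoszD gez0_abs// lerD2r.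
exact: finite_seq.
Qed.

Section grid.
Context {R : realType}.

(** Values are rounded down to multiples of [e]: boundedness leaves finitely many of them, and
    monotonicity of the rounding map gives measurability. *)
Lemma real_simple_approx (g : R -> R) (K e : R) :
  0 < e -> measurable_fun setT g ->
  (forall t, `|g t| <= K) ->
  exists u : R -> R, [/\ finite_set (range u), measurable_fun setT u &
    forall t, `|g t - u t| < e].
Proof.
move=> e0 mg gK; pose h y : R := e * (Num.floor (y / e))%:~R.
exists (h \o g); split.
- have K0 : 0 <= K by apply: le_trans (gK 0).
  pose m := Num.bound (K / e).
  have Km : K / e < m%:R by apply: archi_boundP; rewrite divr_ge0// ltW.
  apply: (@sub_finite_set _ _
    [set e * (z%:~R) | z in [set z : int | `|z| <= m%:Z]]).
    move=> _ [t _ <-] /=; exists (Num.floor (g t / e)) => //.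
    have : `|g t / e| <= m%:R.
      rewrite normrM (gtr0_norm (_ : 0 < e^-1)) ?invr_gt0//.
      apply: le_trans (ltW Km).
      by rewrite ler_pM2r ?invr_gt0.
    rewrite !ler_norml => /andP[m1 m2]; apply/andP; split.
      by rewrite floor_ge_int rmorphN.
    by rewrite -(ler_int R); apply: le_trans (floor_le _) m2.
  exact: finite_image (finite_set_int_le m).
- apply: measurableT_comp => //; apply: nondecreasing_measurable => // y z yz.
  by rewrite /h ler_pM2l// ler_int le_floor// ler_pM2r// invr_gt0.
- move=> t; rewrite /h/=.
  have /andP[h1 h2] := floor_itv (g t / e).
  rewrite ger0_norm; last by rewrite subr_ge0 mulrC -ler_pdivlMr.
  by move: h2; rewrite ltr_pdivrMr// intrD; lra.
Qed.

Lemma complex_simple_approx (f : R -> R[i]) (K e : R) : 0 < e ->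
  measurable_fun setT (fun t => complex.Re (f t)) ->
  measurable_fun setT (fun t => complex.Im (f t)) ->
  (forall t, `|complex.Re (f t)| <= K) ->
  (forall t, `|complex.Im (f t)| <= K) ->
  exists2 s : {fimfun R >-> R[i]}, (forall c, measurable (s @^-1` [set c])) &
    forall t, rnorm (f t - s t) < e.
Proof.
move=> e0 mRe mIm ReK ImK; have e20 : 0 < e / 2 by rewrite divr_gt0.
have [u [fu mu ur]] := real_simple_approx e20 mRe ReK.
have [w [fw mw wr]] := real_simple_approx e20 mIm ImK.
have fs : finite_set (range (fun t => Complex (u t) (w t))).
  apply: sub_finite_set (finite_image2 (@Complex R) fu fw).
  by move=> _ [t _ <-] /=; exists (u t); [exists t|exists (w t); [exists t|]].
have fsm : (fun t => Complex (u t) (w t)) \in fimfun by rewrite inE.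
exists (fimfun_Sub fsm) => [[a b]|t] /=.
  rewrite (_ : _ @^-1` _ = (u @^-1` [set a]) `&` (w @^-1` [set b])).
    apply: measurableI; rewrite -[X in measurable X]setTI; first exact: mu.
    exact: mw.
  by apply/seteqP; split => t /= => [[-> ->]|[-> ->]].
apply: le_lt_trans (rnorm_ReIm _) _; rewrite (splitr e) ltrD//.
  by case: (f t) (ur t).
by case: (f t) (wr t).
Qed.

End grid.

(** * The isometry for bounded integrands and the bound on the best approximation *)

Section spectral_integral_norm.
Context {R : realType} {H : completeNormedModType R[i]}.
Context {dot : {dot H for @Num.conj R[i]}} {E : set R -> H -> H}.
Variables (dot_norm : forall x : H, `|x| ^+ 2 = dot x x)
  (E_res : resolution_of_identity dot E) (x : H).
Local Notation mu := (spectral_mass dot_norm E_res x).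
Local Notation S s := (simple_spectral_integral E s x).

Lemma spectral_integral_norm (f : R -> R[i]) (K : R) :
  measurable_fun setT (fun t => complex.Re (f t)) ->
  measurable_fun setT (fun t => complex.Im (f t)) ->
  (forall t, rnorm (f t) <= K) ->
  ((rnorm (spectral_integral E setT f x) ^+ 2)%:E =
    \int[mu]_t (rnorm (f t) ^+ 2)%:E)%E.
Proof.
move=> mRe mIm fK.
have ReK t : `|complex.Re (f t)| <= K by apply: le_trans (ler_Re_rnorm _) _.
have ImK t : `|complex.Im (f t)| <= K by apply: le_trans (ler_Im_rnorm _) _.
have approx e : 0 < e -> exists2 s : {fimfun R >-> R[i]},
    (forall c, measurable (s @^-1` [set c])) &
    forall t, rnorm ((\1_setT t * f t) - s t) < e.
  move=> e0; have [s ms fs] := complex_simple_approx e0 mRe mIm ReK ImK.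
  by exists s => // t; rewrite indicT mul1r.
have [v fv] := is_spectral_integral_exists dot_norm E_res x approx.
rewrite (spectral_integralP dot_norm E_res fv).
have [s [ms /uniform_rnormP sf sv]] := fv.
have {}sf e : 0 < e -> \forall n \near \oo, forall t, rnorm (f t - s n t) < e.
  by move=> /sf; apply: filterS => n Hn t; have := Hn t; rewrite indicT mul1r.
(* Domination must hold at every index, so the sequence is shifted past the point where it is within
   1 of [f]; then [(K + 1) ^ 2] dominates, integrable because [mu] is finite. *)
have [N _ sN] := sf 1 ltr01.
pose u n t := (rnorm (s (n + N)%N t) ^+ 2)%:E.
have ufin n t : u n t = (rnorm (s (n + N)%N t) * rnorm (s (n + N)%N t))%:E.
  by rewrite /u expr2.
have K0 : 0 <= K by apply: le_trans (fK 0); exact: rnorm_ge0.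
have [] := @dominated_convergence _ _ _ mu setT measurableT u
  (fun t => (rnorm (f t) ^+ 2)%:E) (cst ((K + 1) ^+ 2)%:E).
- by move=> n; exact: measurable_rnorm_fimfun.
- apply/measurable_EFinP; under eq_fun do rewrite rnorm_sqrE.
  by apply: measurable_funD; exact: measurable_funX.
- apply: aeW => t _.
  have st : (fun n => s n t : R[i]^o) @ \oo --> (f t : R[i]^o).
    by apply/rnorm_cvgP => e /sf; apply: filterS => n; exact.
  have := cvg_rnorm st; rewrite -(cvg_shiftn N) => h.
  rewrite expr2; under eq_cvg do rewrite ufin.
  have hh := cvgM h h.
  by apply: cvg_EFin; [exact: nearW|exact: hh].
- by apply: finite_measure_integrable_cst.
- apply: aeW; move=> t n _; rewrite gee0_abs ?lee_fin ?sqr_ge0//.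
  rewrite ler_sqr ?nnegrE ?rnorm_ge0 ?addr_ge0//.
  rewrite -[s _ t](subrK (f t)); apply: le_trans (ler_rnormD _ _) _.
  rewrite addrC lerD ?fK// rnorm_distC ltW//.
  by apply: sN; rewrite /= leq_addl.
move=> _ _ /= h1.
have := cvg_rnorm sv; rewrite -(cvg_shiftn N) => h.
have h2 : (fun n => \int[mu]_t u n t)%E @ \oo --> (rnorm v ^+ 2)%:E.
  rewrite expr2; under eq_cvg do rewrite -simple_spectral_integral_norm// expr2.
  have hh := cvgM h h.
  by apply: cvg_EFin; [exact: nearW|exact: hh].
exact: (cvg_unique _ h2 h1).
Qed.

(** [E D x] is a competitor in the infimum, since the spectral integral of 1 over [D] is [E D x].
    The residual is the projection onto the complement of [D], which contains the boundary |t| =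
    sigma. *)
Lemma best_approx_le (sigma : R) :
  ((best_approx E sigma x <= rnorm (x - E [set t | (`|t| < sigma)%R] x))%R /\
  (rnorm (x - E [set t | (`|t| < sigma)%R] x) ^+ 2)%:E =
    mu [set t | (sigma <= `|t|)%R])%E.
Proof.
set D := [set t | _].
have mD : measurable D.
  rewrite -[D]setTI (_ : D = (fun t : R => `|t|) @^-1` `]-oo, sigma[).
    exact: (@normr_measurable _ setT).
  by apply/seteqP; split => t /=; rewrite in_itv.
split.
  apply: ge_inf; first by exists 0 => _ [h _ <-]; exact: rnorm_ge0.
  exists (E D x) => //; exists x => //; exact: spectral_integral1.
have -> : [set t | sigma <= `|t|] = ~` D.
  by apply/seteqP; split => t /=; rewrite leNgt => /negP.
have := roiU E_res x mD (measurableC mD) (setICr D).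
rewrite setUCr (roi_setT E_res) => xE.
by rewrite /spectral_mass {1}xE addrAC subrr add0r.
Qed.

End spectral_integral_norm.

(** * The weighted modulus *)

Lemma measurable_Vhat (R : realType) (delta : R) :
  measurable_fun setT (fun t : R => Vhat (t / delta)).
Proof.
apply: measurable_fun_ifT => //.
by apply: measurable_fun_ler => //; exact: measurable_funM.
Qed.

Lemma Vhat_ge0 (R : realType) (t : R) : 0 <= Vhat t.
Proof. by rewrite /Vhat; case: ifP => _; lra. Qed.

Lemma Vhat_le (R : realType) (t : R) : Vhat t <= 5 / 4.
Proof. by rewrite /Vhat; case: ifP => _; lra. Qed.

Section weighted_mean.
Context {R : realType}.
Variable delta : R.
Hypothesis delta0 : 0 < delta.
Local Notation leb := (@lebesgue_measure R).
Local Notation I a :=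
  (\int[leb]_(t in `[0%R, delta]) (a t * Vhat (t / delta))%R)%R.

Lemma integrable_Vhat (a : R -> R) (B : R) : measurable_fun setT a ->
  (forall t, 0 <= a t <= B) ->
  leb.-integrable `[0, delta] (EFin \o (fun t => a t * Vhat (t / delta))).
Proof.
move=> ma aB; apply: measurable_bounded_integrable => //.
- by rewrite /= lebesgue_measure_itv/=; case: ifP => _ //; rewrite ltry.
- apply: measurable_funTS; apply: measurable_funM => //; exact: measurable_Vhat.
exists (B * (5 / 4)); split; first exact: num_real.
move=> M BM t _; apply: le_trans (ltW BM).
have /andP[a0 aB'] := aB t.
by rewrite normrM !ger0_norm ?Vhat_ge0// ler_pM ?Vhat_ge0 ?Vhat_le.
Qed.

Lemma Rintegral_Vhat1 : I (fun=> 1) = delta.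
Proof.
rewrite /Rintegral integral_Vhat//.
rewrite !integral_cst//= !lebesgue_measure_itv/= !lte_fin delta0 divr_gt0//.
rewrite !mul1e -!EFinB -!EFinM -EFinD /= !subr0; by field.
Qed.

Lemma Rintegral_VhatZl (k : R) (a : R -> R) (B : R) : measurable_fun setT a ->
  (forall t, 0 <= a t <= B) -> I (fun t => k * a t) = k * I a.
Proof.
move=> ma aB; rewrite -RintegralZl//; last exact: integrable_Vhat aB.
by apply: eq_Rintegral => t _; rewrite mulrA.
Qed.

Lemma Rintegral_Vhat_ge0 (a : R -> R) : (forall t, 0 <= a t) -> 0 <= I a.
Proof.
move=> a0; rewrite fine_ge0// integral_ge0// => t _.
by rewrite lee_fin mulr_ge0// Vhat_ge0.
Qed.

Lemma Rintegral_Vhat_power_mean (a : R -> R) (B r : R) :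
  measurable_fun setT a -> (forall t, 0 <= a t <= B) -> 1 <= r ->
  (delta^-1 * I a) `^ r <= delta^-1 * I (fun t => a t `^ r).
Proof.
move=> ma aB r1; have r0 : 0 < r by apply: lt_le_trans r1.
have a0 t : 0 <= a t by have /andP[] := aB t.
have Iint := integrable_Vhat ma aB.
have mr : measurable_fun setT (fun t => a t `^ r).
  by apply: (measurableT_comp (measurable_powR r)).
have arB t : 0 <= a t `^ r <= B `^ r.
  have /andP[a0' aB'] := aB t; rewrite powR_ge0/=.
  rewrite ge0_ler_powR ?nnegrE ?(ltW r0)//.
  exact: le_trans a0' aB'.
have d0 : 0 <= delta^-1 by rewrite invr_ge0 ltW.
(* The exponent 1 has no finite conjugate [r / (r - 1)] and is settled directly. *)
have [r_eq1|r_neq1] := eqVneq r 1.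
  rewrite r_eq1 powRr1 ?mulr_ge0 ?Rintegral_Vhat_ge0//.
  by rewrite le_eqVlt; apply/orP; left; apply/eqP; congr (_ * _);
     apply: eq_Rintegral => t _; rewrite powRr1.
have {r_neq1}r1 : 1 < r by rewrite lt_neqAle eq_sym r_neq1.
set m := delta^-1 * I a.
have m0 : 0 <= m by rewrite mulr_ge0 ?Rintegral_Vhat_ge0.
pose q := r / (r - 1).
have r10 : 0 < r - 1 by rewrite subr_gt0.
have q0 : 0 < q by rewrite divr_gt0.
have rq : r^-1 + q^-1 = 1.
  by rewrite /q invf_div; field; rewrite gt_eqF.
have mq : (m `^ (r - 1)) `^ q = m `^ r.
  by rewrite -powRrM /q mulrCA mulfV ?mulr1// gt_eqF.
(* Young's inequality against the constant [m `^ (r - 1)], with equality in the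
   constant case [a = m] *)
have young t : m `^ (r - 1) * a t <= r^-1 * a t `^ r + q^-1 * m `^ r * 1.
  rewrite mulrC.
  apply: le_trans (conjugate_powR (a0 t) (powR_ge0 m _) r0 q0 rq) _.
  by rewrite mq mulr1 mulrC (mulrC _ q^-1).
have key : m `^ (r - 1) * I a <=
    r^-1 * I (fun t => a t `^ r) + q^-1 * m `^ r * delta.
  have one01 (t : R) : 0 <= (1 : R) <= 1 by rewrite ler01 lexx.
  have scale (k : R) (f : R -> R) (C : R) : 0 <= k -> measurable_fun setT f ->
      (forall t, 0 <= f t <= C) ->
      leb.-integrable `[0, delta]
        (EFin \o (fun t => k * f t * Vhat (t / delta))).
    move=> k0 mf fC; apply: (@integrable_Vhat _ (k * C)).
      exact: measurable_funM.
    by move=> t; have /andP[f0 fC'] := fC t; rewrite mulr_ge0//= ler_wpM2l.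
  have r10' : 0 <= r^-1 by rewrite invr_ge0 ltW.
  have q10 : 0 <= q^-1 * m `^ r by rewrite mulr_ge0 ?powR_ge0// invr_ge0 ltW.
  have i0 := scale _ _ _ (powR_ge0 m (r - 1)) ma aB.
  have i1 := scale _ _ _ r10' mr arB.
  have i2 := scale _ _ _ q10 (measurable_cst (1 : R)) one01.
  rewrite -(Rintegral_VhatZl _ ma aB) -(Rintegral_VhatZl _ mr arB).
  rewrite -[X in _ + _ * X]Rintegral_Vhat1.
  rewrite -(@Rintegral_VhatZl (q^-1 * m `^ r) (fun=> 1) 1
    (measurable_cst _) one01).
  rewrite -RintegralD//; apply: le_Rintegral => //.
    exact: (integrableD _ i1 i2).
  by move=> t _; rewrite -mulrDl ler_wpM2r ?Vhat_ge0.
have mm : m `^ (r - 1) * m = m `^ r by rewrite mulrC mulr_powRB1.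
have Im : I a = delta * m by rewrite /m mulrA divff ?mul1r// gt_eqF.
move: key; rewrite Im mulrCA mm => key.
(* The integrated Young inequality reads [delta m^r <= I(a^r) / r + delta m^r / q]; since
   [1 - 1/q = 1/r], moving the last term across leaves a common factor [1/r]. *)
have : delta * (r^-1 * m `^ r) <= r^-1 * I (fun t => a t `^ r).
  have rE : r^-1 = 1 - q^-1 by rewrite -rq addrK.
  rewrite [in leLHS]rE mulrBl mul1r mulrBr lerBlDr.
  by apply: le_trans key _; rewrite lerD2l mulrC.
rewrite mulrCA ler_pM2l ?invr_gt0// => h.
by rewrite -(ler_pM2l delta0) [leRHS]mulrA divff ?mul1r// gt_eqF.
Qed.

End weighted_mean.

Section symbol.
Context {R : realType}.

Lemma ler_Re_dist (z w : R[i]) :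
  `|complex.Re z - complex.Re w| <= rnorm (z - w).
Proof. by have := ler_Re_rnorm (z - w); case: z; case: w. Qed.

Lemma ler_Im_dist (z w : R[i]) :
  `|complex.Im z - complex.Im w| <= rnorm (z - w).
Proof. by have := ler_Im_rnorm (z - w); case: z; case: w. Qed.

Lemma continuous_expi : continuous (@expi R : R -> R[i]^o).
Proof.
move=> t; apply/(@rnorm_cvgP R R[i]^o) => e e0.
have e20 : 0 < e / 2 by rewrite divr_gt0.
near=> u; apply: le_lt_trans (rnorm_ReIm _) _ => /=.
rewrite (splitr e) ltrD//; near: u.
- by have /cvgrPdist_lt := @continuous_cos R t; exact.
- by have /cvgrPdist_lt := @continuous_sin R t; exact.
Unshelve. all: end_near. Qed.

Variable phi : R[i] -> R[i].
Hypothesis phi_cont : continuous (phi : R[i]^o -> R[i]^o).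

Lemma continuous_phi_expi : continuous (fun t : R => phi (expi t) : R[i]^o).
Proof.
by move=> t; exact: (continuous_comp (@continuous_expi t) (@phi_cont _)).
Qed.

Lemma measurable_Re_phi_expi (t : R) :
  measurable_fun setT (fun s : R => complex.Re (phi (expi (t * s)))).
Proof.
have c : continuous (fun s : R => complex.Re (phi (expi s))).
  move=> s; apply/cvgrPdist_lt => e e0.
  have /(@rnorm_cvgP R R[i]^o)/(_ e e0) := @continuous_phi_expi s.
  by apply: filterS => u; apply: le_lt_trans; exact: ler_Re_dist.
rewrite (_ : (fun s => _) = fun s => complex.Re (phi (expi (s * t)))).
  by apply: continuous_measurable_fun; exact: continuous_scaled c.
by apply/funext => s; rewrite mulrC.
Qed.

Lemma measurable_Im_phi_expi (t : R) :
  measurable_fun setT (fun s : R => complex.Im (phi (expi (t * s)))).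
Proof.
have c : continuous (fun s : R => complex.Im (phi (expi s))).
  move=> s; apply/cvgrPdist_lt => e e0.
  have /(@rnorm_cvgP R R[i]^o)/(_ e e0) := @continuous_phi_expi s.
  by apply: filterS => u; apply: le_lt_trans; exact: ler_Im_dist.
rewrite (_ : (fun s => _) = fun s => complex.Im (phi (expi (s * t)))).
  by apply: continuous_measurable_fun; exact: continuous_scaled c.
by apply/funext => s; rewrite mulrC.
Qed.

Lemma Psi_bounded (psi : R -> R) : Psi psi -> exists B, forall t, psi t <= B.
Proof.
move=> [[cpsi psi0 per _ _] even _ _].
have pi2 : 0 < pi *+ 2 :> R by rewrite mulrn_wgt0// pi_gt0.
have [c _ Hc] := EVT_max (ltW pi2) (continuous_subspaceT cpsi).
exists (psi c) => t; have -> : psi t = psi `|t|.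
  by have [t0|t0] := leP 0 t; rewrite ?(ger0_norm t0) ?(ltr0_norm t0) ?even.
have /truncn_itv/andP[] : 0 <= `|t| / (pi *+ 2) by rewrite divr_ge0// ltW.
set n := Num.truncn _; rewrite ler_pdivlMr// ltr_pdivrMr// => nt tn.
rewrite -(subrK ((pi *+ 2) *+ n) `|t|) (periodicn per); apply: Hc.
rewrite in_itv/= subr_ge0 -mulr_natl nt/= lerBlDr.
by apply: le_trans (ltW tn) _; rewrite -natr1 mulrDl mul1r addrC.
Qed.

End symbol.

(** * The Tonelli step and the comparison with the modulus *)

Section modulus.
Context {R : realType} {H : completeNormedModType R[i]}.
Context {dot : {dot H for @Num.conj R[i]}} {E : set R -> H -> H}.
Variables (dot_norm : forall x : H, `|x| ^+ 2 = dot x x)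
  (E_res : resolution_of_identity dot E) (x : H).
Local Notation mu := (spectral_mass dot_norm E_res x).
Local Notation leb := (@lebesgue_measure R).
Variable phi : R[i] -> R[i].
Hypothesis phi_cont : continuous (phi : R[i]^o -> R[i]^o).
Hypothesis phi_Psi : Psi (symbol phi).

Lemma Delta_norm (t : R) :
  ((rnorm (Delta E phi t x) ^+ 2)%:E = \int[mu]_s (symbol phi (t * s)%R)%:E)%E.
Proof.
have [B HB] := Psi_bounded phi_Psi.
apply: (@spectral_integral_norm _ _ _ _ dot_norm E_res x _ (Num.sqrt B)).
- exact: measurable_Re_phi_expi.
- exact: measurable_Im_phi_expi.
move=> s; rewrite -[leLHS]ger0_norm ?rnorm_ge0// -sqrtr_sqr ler_wsqrtr//.
exact: HB.
Qed.

Let measurable_symbol (t : R) :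
  measurable_fun setT (fun s : R => (symbol phi (t * s))%:E).
Proof.
have [[cpsi _ _ _ _] _ _ _] := phi_Psi.
apply/measurable_EFinP.
rewrite (_ : (fun s => _) = fun s => symbol phi (s * t)).
  by apply: continuous_measurable_fun; exact: continuous_scaled cpsi.
by apply/funext => s; rewrite mulrC.
Qed.

Lemma Delta_bounded : exists B : R, forall t, rnorm (Delta E phi t x) ^+ 2 <= B.
Proof.
have [[_ psi0 _ _ _] _ _ _] := phi_Psi.
have [B HB] := Psi_bounded phi_Psi.
have B0 : 0 <= B by apply: le_trans (HB 0).
exists (B * rnorm x ^+ 2) => t; rewrite -lee_fin Delta_norm.
rewrite EFinM; have <- : mu setT = (rnorm x ^+ 2)%:E.
  by rewrite /spectral_mass (roi_setT E_res).
rewrite -integral_cst//; apply: ge0_le_integral => //.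
- by move=> s _; rewrite lee_fin.
- by move=> s _; rewrite lee_fin.
Qed.

Let psi2 (z : R * R) : \bar R := (symbol phi (z.1 * z.2))%:E.

Let measurable_psi2 : measurable_fun setT psi2.
Proof.
have [[cpsi _ _ _ _] _ _ _] := phi_Psi.
apply/measurable_EFinP.
apply: (measurableT_comp (continuous_measurable_fun cpsi)).
by apply: measurable_funM; [exact: measurable_fst|exact: measurable_snd].
Qed.

(** By the norm formula this function of [t] is a partial integral of a jointly measurable
    nonnegative kernel, so Tonelli supplies measurability. *)
Lemma measurable_Delta :
  measurable_fun setT (fun t => rnorm (Delta E phi t x) ^+ 2).
Proof.
have [[_ psi0 _ _ _] _ _ _] := phi_Psi.
apply/measurable_EFinP; rewrite (_ : EFin \o _ =
    fun t => (\int[mu]_s (symbol phi (t * s)%R)%:E)%E); last first.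
  by apply/funext => t; exact: Delta_norm.
apply: (measurable_fun_fubini_tonelli_F (m2 := mu) psi2) => // z.
by rewrite lee_fin.
Qed.

(** After the exchange of integrals the inner one runs over [t] with the spectral point [s] fixed.
    It is bounded below by [symbol_weight_lower] where |s| >= sigma, which is |s| delta >= pi, and
    by 0 elsewhere. *)
Lemma integral_Delta_lower (sigma : R) : 0 < sigma ->
  ((pi / sigma * (3 / 4 * mean_value (symbol phi)))%:E *
     mu [set t | (sigma <= `|t|)%R]
  <= \int[leb]_(t in `[0%R, (pi / sigma)%R])
       (rnorm (Delta E phi t x) ^+ 2 * Vhat (t / (pi / sigma)))%R%:E)%E.
Proof.
move=> sigma0; set delta := pi / sigma.
have delta0 : 0 < delta by rewrite divr_gt0// pi_gt0.
have [[_ psi0 _ _ _] _ _ _] := phi_Psi.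
(* Extending the weight by zero turns the integral over [0, delta] into one over the whole line, so
   Tonelli applies on the full product. *)
pose w : R -> R := (fun t => Vhat (t / delta)) \_ `[0, delta].
have w0 t : 0 <= w t by rewrite /w patchE; case: ifP => _ //; exact: Vhat_ge0.
have mw : measurable_fun setT w.
  apply/(measurable_restrictT _ (measurable_itv _)).
  exact: measurable_funTS (measurable_Vhat delta).
pose f (z : R * R) : \bar R := ((w z.1)%:E * psi2 z)%E.
have f0 z : (0 <= f z)%E by rewrite mule_ge0 ?lee_fin// w0.
have mf : measurable_fun setT f.
  apply: emeasurable_funM => //; apply/measurable_EFinP.
  by apply: (measurableT_comp mw); exact: measurable_fst.
have mDelta := measurable_Delta.
rewrite [leRHS](_ : _ = \int[leb]_t \int[mu]_s f (t, s))%E; last first.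
  rewrite integral_mkcond; apply: eq_integral => t _.
  rewrite /f/= ge0_integralZl_EFin//; last 2 first.
  - by move=> s _; rewrite lee_fin.
  - exact: measurable_symbol.
  rewrite -Delta_norm -EFinM /w !patchE; case: ifP => _; last by rewrite mul0r.
  by rewrite mulrC.
have fub : (\int[leb]_t \int[mu]_s f (t, s) =
    \int[mu]_s \int[leb]_t f (t, s))%E.
  exact: fubini_tonelli.
rewrite fub.
have mS : measurable [set t : R | sigma <= `|t|].
  rewrite -[X in measurable X]setTI
    (_ : [set t | _] = (fun t : R => `|t|) @^-1` `[sigma, +oo[).
    exact: (@normr_measurable _ setT).
  by apply/seteqP; split => t /=; rewrite in_itv/= andbT.
rewrite -integral_cst//.
rewrite integral_mkcond; apply: ge0_le_integral => //.
- move=> s _; rewrite patchE; case: ifP => _ //; rewrite lee_fin.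
  have [F [_ _ -> F0 _]] := Psi_primitive phi_Psi.
  by rewrite mulr_ge0 ?(ltW delta0)// !mulr_ge0 ?invr_ge0 ?pi_ge0 ?(ltW F0).
- by apply/(measurable_restrictT _ mS); exact: measurable_cst.
- exact: (measurable_fun_fubini_tonelli_G (m1 := leb) f mf f0).
move=> s _; rewrite patchE; case: ifPn => [|_]; last first.
  by apply: integral_ge0 => t _.
rewrite inE/= => sigma_s.
rewrite (_ : \int[_]_(_ in _) _ = \int[leb]_(t in `[0%R, delta])
    (symbol phi (t * s) * Vhat (t / delta))%R%:E)%E; last first.
  rewrite [RHS]integral_mkcond; apply: eq_integral => t _.
  rewrite /f/psi2/= -EFinM /w !patchE; case: ifP => _; last by rewrite mul0r.
  by rewrite mulrC.
apply: symbol_weight_lower => //.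
by rewrite /delta mulrA ler_pdivlMr// mulrC ler_pM2r// pi_gt0.
Qed.

(** For finite [p = q] the power mean is applied to the squared norm with exponent [q / 2], and
    [q >= 2] is what makes this exponent at least 1. Nonnegativity is recorded because the final
    estimate is proved between squares. *)
Lemma modulus_sqr_lower (p : \bar R) (delta : R) : (2%:E <= p)%E -> 0 < delta ->
  delta^-1 * \int[leb]_(t in `[0, delta])
     (rnorm (Delta E phi t x) ^+ 2 * Vhat (t / delta)) <=
  modulus E phi p (@Vhat R) delta x ^+ 2 /\
  0 <= modulus E phi p (@Vhat R) delta x.
Proof.
move=> p2 delta0; have [B HB] := Delta_bounded.
have mD := measurable_Delta.
have DB t : 0 <= rnorm (Delta E phi t x) ^+ 2 <= B by rewrite sqr_ge0 HB.
case: p p2 => [q|_|//]; last first.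
  rewrite /modulus; set A := [set _ | _ in _].
  have Aub : has_ubound A.
    exists (Num.sqrt B) => _ [t _ <-].
    by rewrite -[leLHS]ger0_norm ?rnorm_ge0// -sqrtr_sqr ler_wsqrtr.
  have Asup t : t \in `[0, delta] -> rnorm (Delta E phi t x) <= sup A.
    by move=> td; apply: sup_ubound => //; exists t.
  have A0 : 0 <= sup A.
    apply: le_trans (Asup 0 _); first exact: rnorm_ge0.
    by rewrite in_itv/= lexx ltW.
  (* Writing [delta] as the integral of the weight makes the right side a weighted integral as well,
     so the two integrands can be compared pointwise. *)
  split=> //; rewrite ler_pdivrMl// -[X in X * _](Rintegral_Vhat1 delta0) mulrC.
  have s1 (t : R) : 0 <= (1 : R) <= 1 by rewrite ler01 lexx.
  rewrite -(Rintegral_VhatZl delta (sup A ^+ 2) (measurable_cst _) s1).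
  apply: le_Rintegral => //.
  - exact: integrable_Vhat DB.
  - apply: (@integrable_Vhat _ delta _ (sup A ^+ 2)) => [|t].
      exact: measurable_funM.
    by rewrite mulr1 sqr_ge0/=.
  - move=> t td; rewrite mulr1 ler_wpM2r ?Vhat_ge0//.
    rewrite ler_sqr ?nnegrE ?rnorm_ge0//.
    exact: Asup.
rewrite lee_fin => q2; have q0 : 0 < q by apply: lt_le_trans q2.
split; last exact: powR_ge0.
rewrite /modulus; set J := (X in X `^ q^-1).
have r1 : 1 <= q / 2 by rewrite ler_pdivlMr// mul1r.
have := Rintegral_Vhat_power_mean delta0 mD DB r1.
set A := _^-1 * _ => AJ.
have JE : A `^ (q / 2) <= J.
  apply: le_trans AJ _; rewrite /J le_eqVlt; apply/orP; left; apply/eqP.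
  congr (_ * _); apply: eq_Rintegral => t _; congr (_ * _).
  rewrite -powR_mulrn ?rnorm_ge0// -powRrM; congr (_ `^ _).
  by rewrite mulrCA divff ?mulr1.
have A0 : 0 <= A.
  rewrite mulr_ge0 ?invr_ge0 ?(ltW delta0)// Rintegral_Vhat_ge0// => t.
  exact: sqr_ge0.
rewrite -powR_mulrn ?powR_ge0// -powRrM.
have -> : A = (A `^ (q / 2)) `^ (q^-1 * 2%:R).
  rewrite -powRrM (_ : q / 2 * _ = 1) ?powRr1//.
  by field; rewrite gt_eqF.
have q20 : 0 <= q^-1 * 2 by rewrite mulr_ge0// invr_ge0 ltW.
have J0 : 0 <= J by apply: le_trans JE; exact: powR_ge0.
by apply: (ge0_ler_powR q20 _ _ JE); rewrite nnegrE// powR_ge0.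
Qed.

End modulus.

Local Close Scope complex_scope.

Theorem mainTheorem8 (R : realType) (H : completeNormedModType R[i])
    (dot : {dot H for @Num.conj R[i]})
    (dot_norm : forall x : H, `|x| ^+ 2 = dot x x)
    (E : set R -> H -> H) (E_res : resolution_of_identity dot E)
    (phi : R[i] -> R[i]) (phi_cont : continuous (phi : R[i]^o -> R[i]^o))
    (phi_Psi : Psi (symbol phi))
    (x : H) (sigma : R) (sigma_gt0 : 0 < sigma)
    (p : \bar R) (p_ge2 : (2%:E <= p)%E) :
  best_approx E sigma x <=
    Num.sqrt (4 / 3) * (1 / Num.sqrt (mean_value (symbol phi))) *
    modulus E phi p (@Vhat R) (pi / sigma) x.
Proof.
set M := mean_value _; set omega := modulus _ _ _ _ _ _.
set delta := pi / sigma.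
have delta0 : 0 < delta by rewrite divr_gt0// pi_gt0.
have M0 : 0 < M.
  have [F [_ _ ME F0 _]] := Psi_primitive phi_Psi.
  by rewrite /M ME mulr_gt0// invr_gt0 pi_gt0.
have [bestE] := best_approx_le dot_norm E_res x sigma.
set y := rnorm (x - _) in bestE * => yE.
have [om om0] :=
  modulus_sqr_lower dot_norm E_res x phi_cont phi_Psi p_ge2 delta0.
have [B HB] := Delta_bounded dot_norm E_res x phi_cont phi_Psi.
have DB t : 0 <= rnorm (Delta E phi t x) ^+ 2 <= B by rewrite sqr_ge0 HB.
have low := integral_Delta_lower dot_norm E_res x phi_cont phi_Psi sigma_gt0.
have iD := integrable_Vhat delta
  (measurable_Delta dot_norm E_res x phi_cont phi_Psi) DB.
have yom : 3 / 4 * M * y ^+ 2 <= omega ^+ 2.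
  apply: le_trans om; rewrite ler_pdivlMl// mulrA -lee_fin EFinM yE.
  (* The modulus uses a real-valued integral and Tonelli an extended one; they agree because
     boundedness of [Delta] makes the integral finite. *)
  apply: le_trans low _; rewrite fineK//; exact: integrable_fin_num iD.
apply: le_trans bestE _.
rewrite -(@ler_pXn2r _ 2)// ?nnegrE ?mulr_ge0 ?invr_ge0 ?sqrtr_ge0 ?rnorm_ge0//.
rewrite !exprMn exprVn expr1n mul1r !sqr_sqrtr ?(ltW M0)//.
rewrite -[leRHS]mulrA mulrCA ler_pdivlMl//; move: yom; lra.
Qed.
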